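(* Let $\chi_1,\chi_2\ge 0$, let $\theta_1,\theta_2\in\mathbb{R}\setminus\pi\mathbb{Z}$, and let $\boldsymbol a,\boldsymbol b$ be pure quaternions with $\boldsymbol a^2=\boldsymbol b^2=-1$. For every $f\in L^1_{\chi_1,\chi_2}(\mathbb R^2;\mathbb H)$, the fractional two-sided quaternionic Dunkl transform satisfies $$\big\|\mathcal{F}_{\chi_1,\chi_2}^{\theta_1,\theta_2;-\boldsymbol a,-\boldsymbol b}\{f\}\big\|_{\infty,\mathbb H}\le C\,\|f\|_{1,\mathbb H,\chi_1,\chi_2},$$ where $$C=\frac{1}{\Gamma(\chi_1+1)\,\Gamma(\chi_2+1)\,2^{\chi_1+\chi_2+2}\,|\sin\theta_1|^{\chi_1+1}\,|\sin\theta_2|^{\chi_2+1}} .$$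
   Context: $\mathbb H$ is the real quaternion algebra with modulus $|\cdot|_{\mathbb H}$. The measure on $\mathbb R^2$ is $d\mu_{\chi_1,\chi_2}(x)=|x_1|^{2\chi_1+1}|x_2|^{2\chi_2+1}dx_1dx_2$; $\|f\|_{1,\mathbb H,\chi_1,\chi_2}=\int|f|_{\mathbb H}\,d\mu_{\chi_1,\chi_2}$, $\|f\|_{\infty,\mathbb H}=\operatorname{ess\,sup}|f|_{\mathbb H}$, and $L^1_{\chi_1,\chi_2}(\mathbb R^2;\mathbb H)$ is the space of measurable $f:\mathbb R^2\to\mathbb H$ with $\|f\|_{1,\mathbb H,\chi_1,\chi_2}<\infty$. For a pure quaternion $q$ with $q^2=-1$, real $u,s$ and $\chi\ge0$, the rank-one Dunkl kernel is $$E_\chi(u,qs)=\frac{\Gamma(\chi+1)}{\sqrt\pi\,\Gamma(\chi+\frac12)}\int_{-1}^1 e^{q\,u s t}(1-t^2)^{\chi-\frac12}(1+t)\,dt .$$ Put $E^{\boldsymbol a}_{\chi_1,\theta_1}(x_1,y_1)=e^{-\frac{\boldsymbol a}{2}(x_1^2+y_1^2)\cot\theta_1}E_{\chi_1}\!\big(x_1,-\boldsymbol a\tfrac{y_1}{\sin\theta_1}\big)$, $E^{\boldsymbol b}_{\chi_2,\theta_2}(x_2,y_2)=E_{\chi_2}\!\big(x_2,-\boldsymbol b\tfrac{y_2}{\sin\theta_2}\big)e^{-\frac{\boldsymbol b}{2}(x_2^2+y_2^2)\cot\theta_2}$, and, with $q_1=\boldsymbol a$, $q_2=\boldsymbol b$,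 $\hat\theta_i=\operatorname{sgn}(\sin\theta_i)$, $$c^{\theta_i}_{\chi_i}=\frac{e^{q_i(\chi_i+1)(\hat\theta_i\pi/2-\theta_i)}}{|\sin\theta_i|^{\chi_i+1}}\cdot\frac{1}{2^{\chi_i+1}\Gamma(\chi_i+1)} .$$ The fractional two-sided quaternionic Dunkl transform of $f\in L^1_{\chi_1,\chi_2}(\mathbb R^2;\mathbb H)$ is $$\mathcal{F}_{\chi_1,\chi_2}^{\theta_1,\theta_2;-\boldsymbol a,-\boldsymbol b}\{f\}(y)=c^{\theta_1}_{\chi_1}c^{\theta_2}_{\chi_2}\int_{\mathbb R^2}E^{\boldsymbol a}_{\chi_1,\theta_1}(x_1,y_1)\,f(x_1,x_2)\,E^{\boldsymbol b}_{\chi_2,\theta_2}(x_2,y_2)\,d\mu_{\chi_1,\chi_2}(x).$$ *)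

(* Defs.v *)
From HB Require Import structures.
From mathcomp Require Import all_boot all_order all_algebra.
From mathcomp Require Import ring.
From mathcomp Require Import all_classical all_reals all_analysis.
From mathcomp Require Import measurable_realfun ess_sup_inf.

Set Implicit Arguments.
Unset Strict Implicit.
Unset Printing Implicit Defensive.

Import Order.TTheory GRing.Theory Num.Theory.
Import numFieldNormedType.Exports.

Local Open Scope classical_set_scope.
Local Open Scope ring_scope.

(* Quat w x y z stands for w + x i + y j + z k. *)
Record quat (R : Type) := Quat { qre : R; qi : R; qj : R; qk : R }.

Section QuaternionAlgebra.
Variable R : realType.

Definition tuple_of_quat (q : quat R) := (qre q, qi q, qj q, qk q).
Definition quat_of_tuple (t : R * R * R * R) :=
  Quat t.1.1.1 t.1.1.2 t.1.2 t.2.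

Lemma tuple_of_quatK : cancel tuple_of_quat quat_of_tuple.
Proof. by case. Qed.

HB.instance Definition _ := Choice.copy (quat R) (can_type tuple_of_quatK).

Definition qadd (p q : quat R) :=
  Quat (qre p + qre q) (qi p + qi q) (qj p + qj q) (qk p + qk q).
Definition qopp (q : quat R) := Quat (- qre q) (- qi q) (- qj q) (- qk q).
Definition qzero : quat R := Quat 0 0 0 0.
Definition qone : quat R := Quat 1 0 0 0.
Definition qscale (r : R) (q : quat R) :=
  Quat (r * qre q) (r * qi q) (r * qj q) (r * qk q).
Definition qmul (p q : quat R) :=
  Quat (qre p * qre q - qi p * qi q - qj p * qj q - qk p * qk q)
       (qre p * qi q + qi p * qre q + qj p * qk q - qk p * qj q)
       (qre p * qj q - qi p * qk q + qj p * qre q + qk p * qi q)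
       (qre p * qk q + qi p * qj q - qj p * qi q + qk p * qre q).

Lemma qaddA : associative qadd.
Proof. by move=> p q r; congr Quat; rewrite /= addrA. Qed.
Lemma qaddC : commutative qadd.
Proof. by move=> p q; congr Quat; rewrite /= addrC. Qed.
Lemma qadd0 : left_id qzero qadd.
Proof. by case=> *; congr Quat; rewrite /= add0r. Qed.
Lemma qaddN : left_inverse qzero qopp qadd.
Proof. by case=> *; congr Quat; rewrite /= addNr. Qed.

HB.instance Definition _ := GRing.isZmodule.Build (quat R)
  qaddA qaddC qadd0 qaddN.

Lemma qmulA : associative qmul.
Proof. by move=> p q r; congr Quat; rewrite /=; ring. Qed.
Lemma qmul1l : left_id qone qmul.
Proof. by case=> *; congr Quat; rewrite /=; ring. Qed.
Lemma qmul1r : right_id qone qmul.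
Proof. by case=> *; congr Quat; rewrite /=; ring. Qed.
Lemma qmulDl : left_distributive qmul qadd.
Proof. by move=> p q r; congr Quat; rewrite /=; ring. Qed.
Lemma qmulDr : right_distributive qmul qadd.
Proof. by move=> p q r; congr Quat; rewrite /=; ring. Qed.
Lemma qone_neq0 : qone != 0.
Proof. by apply/eqP => -[] /eqP; rewrite oner_eq0. Qed.

HB.instance Definition _ := GRing.Zmodule_isNzRing.Build (quat R)
  qmulA qmul1l qmul1r qmulDl qmulDr qone_neq0.

Lemma qscaleA (r s : R) (q : quat R) :
  qscale r (qscale s q) = qscale (r * s) q.
Proof. by congr Quat; rewrite /= mulrA. Qed.
Lemma qscale1 : left_id 1 qscale.
Proof. by case=> *; congr Quat; rewrite /= mul1r. Qed.
Lemma qscaleDr : right_distributive qscale qadd.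
Proof. by move=> r p q; congr Quat; rewrite /= mulrDr. Qed.
Lemma qscaleDl (q : quat R) :
  {morph qscale^~ q : r s / r + s >-> qadd r s}.
Proof. by move=> r s; congr Quat; rewrite /= mulrDl. Qed.

HB.instance Definition _ := GRing.Zmodule_isLmodule.Build R (quat R)
  qscaleA qscale1 qscaleDr qscaleDl.

Lemma qscaleAl (r : R) (p q : quat R) : r *: (p * q) = (r *: p) * q.
Proof. by congr Quat; rewrite /=; ring. Qed.

HB.instance Definition _ := GRing.Lmodule_isLalgebra.Build R (quat R) qscaleAl.

Lemma qscaleAr (r : R) (p q : quat R) : r *: (p * q) = p * (r *: q).
Proof. by congr Quat; rewrite /=; ring. Qed.

HB.instance Definition _ := GRing.Lalgebra_isAlgebra.Build R (quat R) qscaleAr.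

Definition qmod (q : quat R) : R :=
  Num.sqrt (qre q ^+ 2 + qi q ^+ 2 + qj q ^+ 2 + qk q ^+ 2).

Definition pure_quat (q : quat R) : Prop := qre q = 0.

(* The power series of exp in the quaternion algebra, with the limit taken in
   each of the four real coordinates. *)
Definition qexp (q : quat R) : quat R :=
  let S : nat -> quat R := series (fun n => (n`!%:R : R)^-1 *: q ^+ n) in
  Quat (limn (fun n => qre (S n))) (limn (fun n => qi (S n)))
       (limn (fun n => qj (S n))) (limn (fun n => qk (S n))).

End QuaternionAlgebra.

Section QuaternionIntegral.
Context (d : measure_display) (T : measurableType d) (R : realType).
Variable mu : {measure set T -> \bar R}.

Definition qintegral (D : set T) (f : T -> quat R) : quat R :=
  Quat (\int[mu]_(x in D) qre (f x)) (\int[mu]_(x in D) qi (f x))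
       (\int[mu]_(x in D) qj (f x)) (\int[mu]_(x in D) qk (f x)).

Definition qmeasurable (f : T -> quat R) : Prop :=
  [/\ measurable_fun setT (fun x => qre (f x)),
      measurable_fun setT (fun x => qi (f x)),
      measurable_fun setT (fun x => qj (f x)) &
      measurable_fun setT (fun x => qk (f x))].

Definition qnorm1 (f : T -> quat R) : \bar R :=
  (\int[mu]_x (qmod (f x))%:E)%E.

Definition qnormoo (f : T -> quat R) : \bar R :=
  ess_sup mu (fun x => (qmod (f x))%:E).

Definition qL1 (f : T -> quat R) : Prop :=
  qmeasurable f /\ (qnorm1 f < +oo)%E.

End QuaternionIntegral.

Section DunklMeasure.
Variable R : realType.
Variables chi1 chi2 : R.

Definition dunkl_weight (x : R * R) : R :=
  `|x.1| `^ (2 * chi1 + 1) * `|x.2| `^ (2 * chi2 + 1).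

Lemma dunkl_weight_ge0 x : 0 <= dunkl_weight x.
Proof. by rewrite mulr_ge0 ?powR_ge0. Qed.

Lemma measurable_dunkl_weight : measurable_fun setT dunkl_weight.
Proof.
apply: measurable_funM.
- apply: (measurableT_comp (measurable_powR _)).
  by apply: measurableT_comp.
- apply: (measurableT_comp (measurable_powR _)).
  by apply: measurableT_comp.
Qed.

Definition dunkl_measure (A : set (R * R)) : \bar R :=
  (\int[@lebesgue_measure R \x @lebesgue_measure R]_(x in A)
     (dunkl_weight x)%:E)%E.

Let dunkl_measure0 : dunkl_measure set0 = 0%E.
Proof. by rewrite /dunkl_measure integral_set0. Qed.

Let dunkl_measure_ge0 A : (0 <= dunkl_measure A)%E.
Proof. by apply: integral_ge0 => x _; rewrite lee_fin dunkl_weight_ge0. Qed.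

Let dunkl_measure_sigma_additive : semi_sigma_additive dunkl_measure.
Proof.
move=> /= F mF tF mUF; rewrite /dunkl_measure; apply: cvg_toP.
  apply: ereal_nondecreasing_is_cvgn => m n mn.
  apply: lee_sum_nneg_natr => // k _ _; apply: integral_ge0 => x _.
  by rewrite lee_fin dunkl_weight_ge0.
rewrite ge0_integral_bigcup//=.
- apply/measurable_EFinP; apply: measurable_funTS.
  exact: measurable_dunkl_weight.
- by move=> x _; rewrite lee_fin dunkl_weight_ge0.
Qed.

HB.instance Definition _ := isMeasure.Build _ _ _ dunkl_measure
  dunkl_measure0 dunkl_measure_ge0 dunkl_measure_sigma_additive.

End DunklMeasure.

Section DunklTransform.
Variable R : realType.
Implicit Types (chi theta : R) (q z : quat R).

Definition Gamma (s : R) : R :=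
  \int[lebesgue_measure]_(t in `]0, +oo[) (t `^ (s - 1) * expR (- t)).

(* z plays the role of q s with q a pure unit and s real, so that
   exp (q u s t) = exp ((u t) z). *)
Definition dunkl_kernel chi (u : R) z : quat R :=
  (Gamma (chi + 1) / (Num.sqrt pi * Gamma (chi + 2^-1))) *:
  qintegral lebesgue_measure `[-1, 1]
    (fun t => ((1 - t ^+ 2) `^ (chi - 2^-1) * (1 + t)) *: qexp ((u * t) *: z)).

Definition cot theta : R := cos theta / sin theta.

Definition frac_chirp theta q (x y : R) : quat R :=
  qexp (- ((x ^+ 2 + y ^+ 2) * cot theta / 2) *: q).

Definition frac_kernel_left chi theta (a : quat R) (x y : R) : quat R :=
  frac_chirp theta a x y * dunkl_kernel chi x (- (y / sin theta) *: a).

Definition frac_kernel_right chi theta (b : quat R) (x y : R) : quat R :=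
  dunkl_kernel chi x (- (y / sin theta) *: b) * frac_chirp theta b x y.

Definition frac_const chi theta q : quat R :=
  ((`|sin theta| `^ (chi + 1))^-1 * (2 `^ (chi + 1) * Gamma (chi + 1))^-1) *:
  qexp (((chi + 1) * (Num.sg (sin theta) * pi / 2 - theta)) *: q).

Definition frac_dunkl_transform chi1 chi2 theta1 theta2 (a b : quat R)
    (f : R * R -> quat R) (y : R * R) : quat R :=
  frac_const chi1 theta1 a * frac_const chi2 theta2 b *
  qintegral (dunkl_measure chi1 chi2) setT
    (fun x => frac_kernel_left chi1 theta1 a x.1 y.1 * f x *
              frac_kernel_right chi2 theta2 b x.2 y.2).

End DunklTransform.

(* Main.v *)
From HB Require Import structures.
Require Import Defs.
From mathcomp Require Import all_boot all_order all_algebra.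
From mathcomp Require Import ring lra.
From mathcomp Require Import all_classical all_reals all_analysis.
From mathcomp Require Import measurable_realfun ess_sup_inf.

Set Implicit Arguments.
Unset Strict Implicit.
Unset Printing Implicit Defensive.

Import Order.TTheory GRing.Theory Num.Theory.
Import numFieldNormedType.Exports.

Local Open Scope classical_set_scope.
Local Open Scope ring_scope.

(* The two one-variable kernels have modulus at most 1, so the modulus of the
   transform is at most that of its two constants times the L1 norm of f.  With
   q ^+ 2 = -1, exp (r q) = cos r + sin r q has modulus 1, so the bound on the
   Dunkl kernel reduces to the normalization
     Gamma (chi + 1) * int_(-1)^1 (1 - t^2)^(chi - 1/2) (1 + t) dt
       = sqrt pi * Gamma (chi + 1/2).
   The odd part of the weight integrates to 0, and the rest is Tonelli's theorem
   for exp (- r) (r - x^2)_+^(chi - 1/2), integrated over r first (giving the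
   Gaussian integral) or over x first (giving the beta integral). *)

(** * The quaternion modulus and the exponential along a unit with square -1 *)

Section QuaternionModulus.
Variable R : realType.
Implicit Types p q : quat R.

Lemma qmod_ge0 q : 0 <= qmod q.
Proof. exact: sqrtr_ge0. Qed.

Lemma sqr_qmod q : qmod q ^+ 2 = qre q ^+ 2 + qi q ^+ 2 + qj q ^+ 2 + qk q ^+ 2.
Proof. by rewrite sqr_sqrtr// !addr_ge0// sqr_ge0. Qed.

(** Once both sides are squared, this is Euler's four-square identity. *)
Lemma qmodM p q : qmod (p * q) = qmod p * qmod q.
Proof.
apply/eqP; rewrite -(@eqrXn2 _ 2) ?mulr_ge0 ?qmod_ge0//.
by rewrite exprMn !sqr_qmod /=; apply/eqP; ring.
Qed.

Lemma qmodZ (r : R) q : qmod (r *: q) = `|r| * qmod q.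
Proof.
apply/eqP; rewrite -(@eqrXn2 _ 2) ?mulr_ge0 ?qmod_ge0//.
by rewrite exprMn !sqr_qmod /= real_normK ?num_real//; apply/eqP; ring.
Qed.

Lemma qmod_coord q (x : R) :
  x \in [:: qre q; qi q; qj q; qk q] -> `|x| <= qmod q.
Proof.
move=> xq; rewrite -(@ler_pXn2r _ 2) ?nnegrE ?qmod_ge0//.
rewrite sqr_qmod real_normK ?num_real//.
have := sqr_ge0 (qre q); have := sqr_ge0 (qi q).
have := sqr_ge0 (qj q); have := sqr_ge0 (qk q).
by move: xq; rewrite !inE => /or4P[] /eqP ->; lra.
Qed.

Definition qdot p q : R :=
  qre p * qre q + qi p * qi q + qj p * qj q + qk p * qk q.

Lemma qdotxx q : qdot q q = qmod q ^+ 2.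
Proof. by rewrite sqr_qmod /qdot; ring. Qed.

(* The dot product is the real part of the conjugate of p times q, so that
   Cauchy-Schwarz follows from the multiplicativity of qmod. *)
Lemma qdot_le p q : qdot p q <= qmod p * qmod q.
Proof.
pose pc := Quat (qre p) (- qi p) (- qj p) (- qk p).
have -> : qdot p q = qre (pc * q) by rewrite /qdot /=; ring.
have -> : qmod p = qmod pc by rewrite /qmod /= !sqrrN.
by rewrite -qmodM (le_trans (ler_norm _))// qmod_coord// !inE eqxx.
Qed.

(** The imaginary coordinates of [q ^+ 2] are [2 x y], [2 x z] and [2 x w]. If [x] were nonzero they
    would force [y = z = w = 0], hence [x ^+ 2 = -1]. With [x = 0], the real coordinate gives the
    modulus. *)
Lemma sqr_opp1_quat q : q ^+ 2 = -1 -> qre q = 0 /\ qmod q = 1.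
Proof.
case: q => x y z w [] /=; rewrite oppr0 => Hx Hy Hz Hw.
have x0 : x = 0.
  apply/eqP; apply: contra_eqT Hx => x0.
  have f u : x * u + u * x = 0 -> u = 0.
    rewrite [u * x]mulrC -mulr2n -mulrnAl => /eqP.
    by rewrite mulf_eq0 mulrn_eq0/= (negbTE x0)/= => /eqP.
  have -> : y = 0 by apply: f; rewrite -[RHS]Hy; ring.
  have -> : z = 0 by apply: f; rewrite -[RHS]Hz; ring.
  have -> : w = 0 by apply: f; rewrite -[RHS]Hw; ring.
  rewrite !mulr0 !subr0 -expr2; apply/eqP => H; have := sqr_ge0 x; lra.
split=> //; apply/eqP; rewrite -(@eqrXn2 _ 2) ?qmod_ge0// sqr_qmod /=.
by apply/eqP; move: Hx; rewrite x0; lra.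
Qed.

Lemma qmodDZ q (r s : R) : q ^+ 2 = -1 ->
  qmod (r *: 1 + s *: q) = Num.sqrt (r ^+ 2 + s ^+ 2).
Proof.
move=> /sqr_opp1_quat[q0 q1]; rewrite /qmod /= q0; congr Num.sqrt.
have := sqr_qmod q; rewrite q0 q1 expr1n => h.
by rewrite -[s ^+ 2 in RHS]mulr1 [X in s ^+ 2 * X]h; ring.
Qed.

(** The coefficients are written in the shape of [cos_coeff] and [sin_coeff], so that the
    exponential series splits term by term into the cosine and sine series. *)
Lemma expr_quat_unit q n : q ^+ 2 = -1 ->
  q ^+ n = ((~~ odd n)%:R * (-1) ^+ n./2 : R) *: 1 +
           ((odd n)%:R * (-1) ^+ n.-1./2 : R) *: q.
Proof.
move=> q2; rewrite -{1}(odd_double_half n) exprD -mul2n exprM q2.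
have -> : (-1 : quat R) ^+ n./2 = ((-1) ^+ n./2 : R) *: 1.
  by rewrite -scaleN1r exprZn expr1n.
case: (boolP (odd n)) => on /=.
  have -> : n.-1./2 = n./2.
    by rewrite -[in LHS](odd_double_half n) on /= doubleK.
  by rewrite mul0r scale0r add0r mul1r expr1 -scalerAr mulr1.
by rewrite expr0 !mul1r mul0r scale0r addr0.
Qed.

Lemma qexp_unit q (r : R) : q ^+ 2 = -1 ->
  qexp (r *: q) = cos r *: 1 + sin r *: q.
Proof.
move=> q2; rewrite /qexp.
have SE n : series (fun n => (n`!%:R : R)^-1 *: (r *: q) ^+ n) n =
    series (cos_coeff r) n *: 1 + series (sin_coeff r) n *: q.
  elim: n => [|n IH]; first by rewrite /series /= !big_geq// !scale0r addr0.
  rewrite !seriesSr IH exprZn (expr_quat_unit _ q2) /cos_coeff /sin_coeff.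
  rewrite !scalerDl addrACA; congr (_ + _).
  rewrite !scalerDr !scalerA.
  by congr (_ *: _ + _ *: _); rewrite /= -?exprnP; ring.
have cC := @is_cvg_series_cos_coeff R r.
have cS := @is_cvg_series_sin_coeff R r.
(* Each coordinate of the partial sum has this form, with [x] and [y] the corresponding coordinates
   of [1] and [q]; one limit serves all four. *)
have L (x y : R) : limn (fun n => series (cos_coeff r) n * x +
    series (sin_coeff r) n * y) = cos r * x + sin r * y.
  apply/cvg_lim => //; rewrite cos.unlock sin.unlock.
  by apply: cvgD; apply: cvgMl.
by congr Quat; under eq_fun do rewrite SE; exact: L.
Qed.

Lemma qmod_qexp_unit q (r : R) : q ^+ 2 = -1 -> qmod (qexp (r *: q)) = 1.
Proof.
by move=> q2; rewrite qexp_unit// qmodDZ// cos2Dsin2 sqrtr1.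
Qed.

End QuaternionModulus.

(** * Lebesgue integrals under translation, dilation and reflection *)

Section LebesgueAffine.
Variable R : realType.
Local Notation mu := (@lebesgue_measure R).
Local Open Scope ereal_scope.

(** Lebesgue measure is determined by its values on half-open intervals, where the claim is
    arithmetic on the endpoints. *)
Lemma lebesgue_measureD (c : R) (A : set R) : measurable A ->
  pushforward mu
    (fun x : measurableTypeR R => (x + c)%R : measurableTypeR R) A = mu A.
Proof.
move=> mA.
pose phi := (fun x : measurableTypeR R => (x + c)%R : measurableTypeR R).
have mphi : measurable_fun setT phi by exact: measurable_funD.
pose mphi_pack : {mfun _ >-> _} :=
  HB.pack phi (isMeasurableFun.Build _ _ _ _ _ mphi).
apply/esym/(@lebesgue_measure_unique R
  (pushforward mu mphi_pack)) => //= _ [[a b]] _ <-.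
rewrite /pushforward.
have -> : (fun x : R => (x + c)%R) @^-1` `]a, b]%classic =
    `](a - c)%R, (b - c)%R]%classic.
  by apply/seteqP; split => x /=; rewrite !in_itv/= ltrBlDr lerBrDr.
rewrite !lebesgue_measure_itv/= !lte_fin ltrD2r; case: ifP => // _.
by rewrite -!EFinB; congr EFin; lra.
Qed.

Lemma ge0_integral_translation (c : R) (f : R -> \bar R) :
  measurable_fun setT f -> (forall x, 0 <= f x) ->
  \int[mu]_x f (x + c)%R = \int[mu]_x f x.
Proof.
move=> mf f0.
pose phi := (fun x : measurableTypeR R => (x + c)%R : measurableTypeR R).
have mphi : measurable_fun setT phi by exact: measurable_funD.
rewrite -[LHS]/(\int[mu]_(x in phi @^-1` setT) (f \o phi) x).
rewrite -(ge0_integral_pushforward mphi)//.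
by apply: eq_measure_integral => //= A mA _; exact: lebesgue_measureD.
Qed.

(** The preimage of an interval under multiplication by [c] is shorter by the factor [c]; uniqueness
    is therefore applied to the pushforward rescaled by [c]. *)
Lemma lebesgue_measureZ (c : R) (A : set R) : (0 < c)%R -> measurable A ->
  c%:E * pushforward mu
    (fun x : measurableTypeR R => (c * x)%R : measurableTypeR R) A = mu A.
Proof.
move=> c0 mA.
pose phi := (fun x : measurableTypeR R => (c * x)%R : measurableTypeR R).
have mphi : measurable_fun setT phi by exact: measurable_funM.
pose mphi_pack : {mfun _ >-> _} :=
  HB.pack phi (isMeasurableFun.Build _ _ _ _ _ mphi).
apply/esym/(@lebesgue_measure_unique R
  (mscale (NngNum (ltW c0)) (pushforward mu mphi_pack))) => //= _ [[a b]] _ <-.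
rewrite /mscale /= /pushforward.
have -> : phi @^-1` `]a, b]%classic = `](a / c)%R, (b / c)%R]%classic.
  apply/seteqP; split => x /=;
    by rewrite !in_itv/= ltr_pdivrMr// ler_pdivlMr// mulrC.
rewrite !lebesgue_measure_itv/= !lte_fin ltr_pM2r ?invr_gt0//.
case: ifP => // _.
  rewrite -!EFinB -EFinM; congr EFin; rewrite -mulrBl mulrCA divff ?mulr1//.
  exact: lt0r_neq0.
by rewrite mule0.
Qed.

Lemma ge0_integral_dilation (c : R) (f : R -> \bar R) : (0 < c)%R ->
  measurable_fun setT f -> (forall x, 0 <= f x) ->
  \int[mu]_x f x = c%:E * \int[mu]_x f (c * x)%R.
Proof.
move=> c0 mf f0.
pose phi := (fun x : measurableTypeR R => (c * x)%R : measurableTypeR R).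
have mphi : measurable_fun setT phi by exact: measurable_funM.
have -> : \int[mu]_x f (c * x)%R = \int[mu]_(x in phi @^-1` setT) (f \o phi) x.
  by [].
rewrite -(ge0_integral_pushforward mphi)//.
pose mphi_pack : {mfun _ >-> _} :=
  HB.pack phi (isMeasurableFun.Build _ _ _ _ _ mphi).
rewrite -[c in c%:E]/((NngNum (ltW c0))%:num).
rewrite -(@ge0_integral_mscale _ _ _ (pushforward mu mphi_pack))//.
by apply: eq_measure_integral => //= A mA _; exact/esym/lebesgue_measureZ.
Qed.

Lemma ge0_integral_reflection (f : R -> \bar R) :
  measurable_fun setT f -> (forall x, 0 <= f x) ->
  \int[mu]_x f (- x)%R = \int[mu]_x f x.
Proof.
move=> mf f0.
pose phi := (-%R : measurableTypeR R -> measurableTypeR R).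
have mphi : measurable_fun setT phi by exact: oppr_measurable.
rewrite -[LHS]/(\int[mu]_(x in phi @^-1` setT) (f \o phi) x).
rewrite -(ge0_integral_pushforward mphi)//.
by apply: eq_measure_integral => //= A mA _; exact: lebesgue_measureN.
Qed.

End LebesgueAffine.

(** * The Gamma integral and the symmetric beta integral *)

Section GammaBeta.
Variable R : realType.
Local Notation mu := (@lebesgue_measure R).

(* The indicator discards the values of powR outside the positive half-line,
   where powR is not the real power function. *)
Definition pos_powR (p s : R) : R := \1_(`]0, +oo[) s * s `^ p.

Lemma pos_powR_ge0 p s : 0 <= pos_powR p s.
Proof. by rewrite mulr_ge0 ?powR_ge0. Qed.

Lemma pos_powR_gt0 p s : 0 < s -> pos_powR p s = s `^ p.
Proof.
by move=> s0; rewrite /pos_powR indicE mem_set ?mul1r//= in_itv/= s0.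
Qed.

Lemma pos_powR_le0 p s : s <= 0 -> pos_powR p s = 0.
Proof.
move=> s0; rewrite /pos_powR indicE memNset ?mul0r//= in_itv/= andbT.
by apply/negP; rewrite -leNgt.
Qed.

Lemma pos_powRM p r s : 0 < r -> pos_powR p (r * s) = r `^ p * pos_powR p s.
Proof.
move=> r0; have [s0|s0] := leP s 0.
  by rewrite !pos_powR_le0 ?mulr0// pmulr_rle0.
by rewrite !pos_powR_gt0 ?mulr_gt0// powRM// ltW.
Qed.

Lemma measurable_pos_powR p : measurable_fun setT (pos_powR p).
Proof. exact: measurable_funM. Qed.

Lemma measurable_pos_powR_subr p d (T : measurableType d) (g h : T -> R) :
  measurable_fun setT g -> measurable_fun setT h ->
  measurable_fun setT (fun x => pos_powR p (g x - h x ^+ 2)).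
Proof.
move=> mg mh; apply: (measurableT_comp (measurable_pos_powR p)).
by apply: measurable_funB => //; exact: measurable_funX.
Qed.

Local Open Scope ereal_scope.

(** Values are kept in the extended reals and the integral runs over the whole line, so that
    Tonelli's theorem and the changes of variable apply without proving convergence. *)
Definition eGamma (s : R) : \bar R :=
  \int[mu]_t (pos_powR (s - 1) t * expR (- t))%:E.

Lemma fine_eGamma s : fine (eGamma s) = Gamma s.
Proof.
rewrite /Gamma /Rintegral integral_mkcond; congr fine.
apply: eq_integral => t _; rewrite patchE.
case: ifPn => [|] tI.
  have t0 : (0 < t)%R by move: tI; rewrite inE/= in_itv/= andbT.
  by rewrite pos_powR_gt0.
have t0 : (t <= 0)%R.
  by move: tI; rewrite notin_setE/= in_itv/= andbT => /negP; rewrite -leNgt.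
by rewrite pos_powR_le0// mul0r.
Qed.

(** Substituting [u = t ^+ 2] turns this into the beta integral B(1/2, p). *)
Definition sym_beta (p : R) : \bar R :=
  \int[mu]_t (pos_powR (p - 1) (1 - t ^+ 2))%:E.

(* Write [sqrt pi] as the Gaussian integral and substitute [s = r - x ^+ 2],
   then [x = sqrt r * t]. *)
Lemma eGamma_sym_beta p :
  eGamma (p + 2^-1) * sym_beta p = (Num.sqrt pi)%:E * eGamma p.
Proof.
pose w := pos_powR (p - 1).
have mw : measurable_fun setT w by exact: measurable_pos_powR.
have w0 x : (0 <= w x)%R by exact: pos_powR_ge0.
have mwe : measurable_fun setT (fun s => (w s * expR (- s))%R).
  by apply: measurable_funM => //; exact: measurableT_comp.
have sqE (r t : R) : (0 < r)%R ->
    (r - (Num.sqrt r * t) ^+ 2 = r * (1 - t ^+ 2))%R.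
  by move=> r0; rewrite exprMn sqr_sqrtr ?ltW//; ring.
have mF : measurable_fun setT
    (fun z : R * R => (w (z.2 - z.1 ^+ 2) * expR (- z.2))%:E).
  apply/measurable_EFinP; apply: measurable_funM.
    exact: measurable_pos_powR_subr.
  by apply: measurableT_comp => //; exact: measurableT_comp.
have F0 (z : R * R) : 0 <= (w (z.2 - z.1 ^+ 2) * expR (- z.2))%:E.
  by rewrite lee_fin mulr_ge0// expR_ge0.
have G0 s : 0 <= eGamma s.
  apply: integral_ge0 => t _.
  by rewrite lee_fin mulr_ge0 ?pos_powR_ge0 ?expR_ge0.
have B0 : 0 <= sym_beta p.
  by apply: integral_ge0 => t _; rewrite lee_fin.
rewrite -integralT_gauss -[RHS]ge0_integralZr//; last 2 first.
  - by apply/measurable_EFinP; exact: measurable_gauss_fun.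
  - by move=> x _; rewrite lee_fin gauss_fun_ge0.
transitivity (\int[mu]_x \int[mu]_r (w (r - x ^+ 2) * expR (- r))%:E); last first.
  apply: eq_integral => x _.
  rewrite -ge0_integralZl//; last 2 first.
  - by move=> s _; rewrite lee_fin mulr_ge0 ?pos_powR_ge0 ?expR_ge0.
  - by rewrite lee_fin gauss_fun_ge0.
  (* The shift makes the exponentials combine: exp (- x^2) exp (- (r - x^2)) = exp (- r). *)
  rewrite -[RHS](ge0_integral_translation (- x ^+ 2)%R); last 2 first.
  - by apply: measurable_funeM; exact/measurable_EFinP.
  - by move=> s; rewrite mule_ge0// lee_fin ?gauss_fun_ge0// mulr_ge0// expR_ge0.
  apply: eq_integral => r _; rewrite -EFinM; congr EFin.
  by rewrite mulrCA -expRD; congr (_ * expR _)%R; ring.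
  exact/measurable_EFinP.
transitivity (\int[mu]_r \int[mu]_x (w (r - x ^+ 2) * expR (- r))%:E); last first.
  have H := @fubini_tonelli _ _ _ _ R mu mu _ mF F0. exact/esym/H.
rewrite -ge0_integralZr//; last 2 first.
  - apply/measurable_EFinP/measurable_funM; first exact: measurable_pos_powR.
    exact: measurableT_comp.
  - by move=> x _; rewrite lee_fin mulr_ge0 ?pos_powR_ge0 ?expR_ge0.
apply: eq_integral => r _.
(* For [r <= 0] both integrands vanish; only for [r > 0] can [x] be rescaled by [Num.sqrt r]. *)
have [r0|r0] := leP r 0%R.
  rewrite pos_powR_le0// mul0r mul0e integral0_eq// => x _.
  by rewrite /w pos_powR_le0 ?mul0r// subr_le0 (le_trans r0)// sqr_ge0.
have sr0 : (0 < Num.sqrt r)%R by rewrite sqrtr_gt0.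
have mB : measurable_fun setT (fun t : R => w (1 - t ^+ 2)%R).
  exact: measurable_pos_powR_subr.
rewrite [LHS]muleC /sym_beta -ge0_integralZr//; last 3 first.
  - exact/measurable_EFinP.
  - by move=> t _; rewrite lee_fin.
  - by rewrite lee_fin mulr_ge0 ?pos_powR_ge0 ?expR_ge0.
rewrite [RHS](ge0_integral_dilation sr0); last 2 first.
  - apply/measurable_EFinP; apply: measurable_funM => //.
    exact: measurable_pos_powR_subr.
  - by move=> x; rewrite lee_fin mulr_ge0 ?expR_ge0.
rewrite -[RHS]ge0_integralZl; first last.
- by rewrite lee_fin ltW.
- by move=> x _; rewrite lee_fin mulr_ge0 ?expR_ge0.
- apply/measurable_EFinP; apply: measurable_funM => //.
  by apply: measurable_pos_powR_subr => //; exact: measurable_funM.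
- exact: measurableT.
apply: eq_integral => t _; rewrite -!EFinM; congr EFin.
rewrite sqE// /w pos_powRM// (pos_powR_gt0 _ r0).
(* The factor of exponent [2^-1] comes from the dilation by [Num.sqrt r], the one of exponent
   [p - 1] from the homogeneity of [pos_powR]. *)
have -> : (p + 2^-1 - 1 = 2^-1 + (p - 1))%R by ring.
rewrite (@powRD _ r 2^-1); last by apply/implyP => _; rewrite gt_eqF.
by rewrite powR12_sqrt ?ltW//; ring.
Qed.

End GammaBeta.

(** * Normalization of the Dunkl kernel weight *)

Section DunklWeight.
Variable R : realType.
Local Notation mu := (@lebesgue_measure R).
Local Open Scope ereal_scope.

(** Adding the integral to its reflection replaces [1 + t] by [(1 - t) + (1 + t) = 2]. The odd part
    is thus removed using nonnegative integrands only. *)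
Lemma sym_beta_weighted (p : R) :
  \int[mu]_t (pos_powR (p - 1) (1 - t ^+ 2) * (1 + t))%:E = sym_beta p.
Proof.
pose w t := pos_powR (p - 1) (1 - t ^+ 2).
have mw : measurable_fun setT w.
  apply: measurableT_comp; first exact: measurable_pos_powR.
  by apply: measurable_funB => //; exact: measurable_funX.
have w0 t : (0 <= w t)%R by exact: pos_powR_ge0.
(* Where [1 + t] is negative, [t ^+ 2] exceeds 1 and [w t] vanishes. *)
have v0 t : (0 <= w t * (1 + t))%R.
  have [t1|t1] := leP (1 - t ^+ 2)%R 0%R.
    by rewrite /w pos_powR_le0// mul0r.
  by rewrite mulr_ge0//; nra.
have wN t : w (- t)%R = w t by rewrite /w sqrrN.
have mv : measurable_fun setT (fun t => (w t * (1 + t))%:E).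
  apply/measurable_EFinP; apply: measurable_funM => //.
  exact: measurable_funD.
have mvN : measurable_fun setT (fun t => (w t * (1 - t))%:E).
  apply/measurable_EFinP; apply: measurable_funM => //.
  exact: measurable_funB.
(* The integrals may be infinite for arbitrary [p], so the factor 2 is cancelled by cases on
   extended reals. *)
have twice (x y : \bar R) : x + x = 2%:E * y -> x = y.
  rewrite -mule2n -mule_natl; case: x y => [x| |] [y| |] //=.
  - by rewrite -!EFinM => -[h]; congr EFin; lra.
  - by rewrite mulry gtr0_sg// mul1e.
  - by rewrite mulrNy gtr0_sg// mul1e.
  - by rewrite mulry gtr0_sg// mul1e.
  - by rewrite mulry mulrNy gtr0_sg// !mul1e.
  - by rewrite mulrNy gtr0_sg// mul1e.
  - by rewrite mulry mulrNy gtr0_sg// !mul1e.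
apply: twice.
rewrite -[X in X + _](ge0_integral_reflection mv); last first.
  by move=> t; rewrite lee_fin.
under [X in X + _]eq_integral do rewrite wN.
rewrite -[LHS]ge0_integralD; first last.
- exact: mv.
- by move=> t _; exact: v0.
- exact: mvN.
- by move=> t _; have := v0 (- t)%R; rewrite wN.
- exact: measurableT.
rewrite /sym_beta -[RHS]ge0_integralZl; first last.
- by rewrite lee_fin.
- by move=> t _; exact: w0.
- exact/measurable_EFinP.
- exact: measurableT.
apply: eq_integral => t _; rewrite -!EFinD -EFinM; congr EFin.
by rewrite /w; ring.
Qed.

Definition kernel_weight (chi t : R) : R :=
  ((1 - t ^+ 2) `^ (chi - 2^-1) * (1 + t))%R.

Lemma measurable_kernel_weight chi : measurable_fun setT (kernel_weight chi).
Proof.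
apply: measurable_funM; last exact: measurable_funD.
apply: (measurableT_comp (measurable_powR _)).
by apply: measurable_funB => //; exact: measurable_funX.
Qed.

Lemma kernel_weight_ge0 chi t :
  t \in `[-1, 1]%R -> (0 <= kernel_weight chi t)%R.
Proof.
by rewrite in_itv/= => /andP[t1 _]; rewrite mulr_ge0 ?powR_ge0//; lra.
Qed.

Lemma integral_kernel_weight chi :
  \int[mu]_(t in `[(-1)%R, 1%R]) (kernel_weight chi t)%:E =
  sym_beta (chi + 2^-1).
Proof.
(* The endpoints are dropped because the integrands can differ there: for [chi = 2^-1] and [t = 1],
   the power with base and exponent 0 is 1, whereas [pos_powR] is 0. *)
rewrite integral_itv_bndoo; last first.
  apply: measurable_funTS; apply/measurable_EFinP.
  exact: measurable_kernel_weight.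
rewrite integral_mkcond -sym_beta_weighted; apply: eq_integral => t _.
have -> : (chi + 2^-1 - 1 = chi - 2^-1)%R by lra.
rewrite patchE; case: ifPn => tI.
  move: tI; rewrite inE/= in_itv/= => /andP[t1 t2].
  by rewrite pos_powR_gt0//; nra.
rewrite pos_powR_le0 ?mul0r//.
move: tI; rewrite notin_setE/= in_itv/= => /negP.
by rewrite negb_and -!leNgt => /orP[]; nra.
Qed.

Definition kernel_norm (chi : R) : R :=
  (Gamma (chi + 1) / (Num.sqrt pi * Gamma (chi + 2^-1)))%R.

Lemma Gamma_ge0 (s : R) : (0 <= Gamma s)%R.
Proof.
by apply: Rintegral_ge0 => t _; rewrite mulr_ge0 ?powR_ge0 ?expR_ge0.
Qed.

Lemma kernel_norm_ge0 chi : (0 <= kernel_norm chi)%R.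
Proof. by rewrite divr_ge0 ?mulr_ge0 ?Gamma_ge0 ?sqrtr_ge0. Qed.

(* [Gamma] is [0] where its integral diverges, and dividing by [0] gives [0];
   so nonvanishing of [kernel_norm] entails that both integrals converge. *)
Lemma integral_kernel_weightE chi : kernel_norm chi != 0%R ->
  \int[mu]_(t in `[(-1)%R, 1%R]) (kernel_weight chi t)%:E =
  ((kernel_norm chi)^-1)%:E.
Proof.
rewrite mulf_eq0 negb_or invr_eq0 mulf_eq0 negb_or => /and3P[g0 s0 h0].
have fin s : Gamma s != 0%R -> eGamma s = (Gamma s)%:E.
  by rewrite -fine_eGamma; case: (eGamma s) => //=; rewrite eqxx.
rewrite integral_kernel_weight.
have := eGamma_sym_beta (chi + 2^-1).
have -> : (chi + 2^-1 + 2^-1 = chi + 1)%R by lra.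
rewrite !fin// -EFinM invf_div.
have gp : (0 < Gamma (chi + 1))%R by rewrite lt0r g0 Gamma_ge0.
(* A positive real times an infinite value is infinite, so the identity forces [sym_beta] to be
   real. *)
case: sym_beta => [x| |].
- by rewrite -EFinM => -[<-]; congr EFin; rewrite mulrC mulKf.
- by rewrite mulry gtr0_sg// mul1e.
- by rewrite mulrNy gtr0_sg// mul1e.
Qed.

End DunklWeight.

(** * Measurability and the triangle inequality for quaternion integrals *)

Section QuaternionIntegration.
Context d (T : measurableType d) (R : realType).
Implicit Types (F G : T -> quat R).

Lemma qmeasurable_mul F G :
  qmeasurable F -> qmeasurable G -> qmeasurable (fun x => F x * G x).
Proof.
move=> [Fr Fi Fj Fk] [Gr Gi Gj Gk].
by split=> /=; do ?[apply: measurable_funB | apply: measurable_funD];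
  exact: measurable_funM.
Qed.

Lemma measurable_qmod F : qmeasurable F -> measurable_fun setT (@qmod R \o F).
Proof.
move=> [Fr Fi Fj Fk].
have msqrt : measurable_fun setT (@Num.sqrt R).
  by apply: continuous_measurable_fun; exact: sqrt_continuous.
have msq : measurable_fun setT (fun x =>
    qre (F x) ^+ 2 + qi (F x) ^+ 2 + qj (F x) ^+ 2 + qk (F x) ^+ 2).
  by do ?apply: measurable_funD; exact: measurable_funX.
exact: (measurableT_comp msqrt msq).
Qed.

Lemma qmeasurable_cos_sin (q : quat R) (c s : T -> R) :
  measurable_fun setT c -> measurable_fun setT s ->
  qmeasurable (fun x => c x *: 1 + s x *: q).
Proof.
by move=> mc ms; split=> /=; apply: measurable_funD; exact: measurable_funM.
Qed.

Variable mu : {measure set T -> \bar R}.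

(** Pair the integral [v] with itself: |v|^2 is the integral of [qdot v (F x)], hence at most |v|
    times the integral of |F| by Cauchy-Schwarz. Then divide by |v|. *)
Lemma le_qmod_qintegral (D : set T) F : measurable D -> qmeasurable F ->
  (\int[mu]_(x in D) (qmod (F x))%:E < +oo)%E ->
  ((qmod (qintegral mu D F))%:E <= \int[mu]_(x in D) (qmod (F x))%:E)%E.
Proof.
move=> mD mF Foo.
have iM : mu.-integrable D (EFin \o (@qmod R \o F)).
  apply/integrableP; split.
    by apply: measurable_funTS; apply/measurable_EFinP; exact: measurable_qmod.
  under eq_integral do rewrite gee0_abs ?lee_fin ?qmod_ge0//.
  exact: Foo.
(* Every coordinate is dominated by the modulus, hence integrable; this licenses the linearity used
   below. *)
have iC (h : quat R -> R) : measurable_fun setT (h \o F) ->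
    (forall q, `|h q| <= qmod q) -> mu.-integrable D (EFin \o (h \o F)).
  move=> mh hq; apply: le_integrable iM => //.
    by apply: measurable_funTS; apply/measurable_EFinP.
  by move=> x _; rewrite lee_fin (le_trans (hq _))// ler_norm.
have [Fr Fi Fj Fk] := mF.
have iFr : mu.-integrable D (EFin \o (@qre R \o F)).
  by apply: iC => // q; apply: qmod_coord; rewrite !inE eqxx ?orbT.
have iFi : mu.-integrable D (EFin \o (@qi R \o F)).
  by apply: iC => // q; apply: qmod_coord; rewrite !inE eqxx ?orbT.
have iFj : mu.-integrable D (EFin \o (@qj R \o F)).
  by apply: iC => // q; apply: qmod_coord; rewrite !inE eqxx ?orbT.
have iFk : mu.-integrable D (EFin \o (@qk R \o F)).
  by apply: iC => // q; apply: qmod_coord; rewrite !inE eqxx ?orbT.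
have iZ (h : T -> R) (r : R) : mu.-integrable D (EFin \o h) ->
    mu.-integrable D (EFin \o (fun x => r * h x)).
  by move=> ih; have := integrableZl mD r ih.
have iDD (h g : T -> R) : mu.-integrable D (EFin \o h) ->
    mu.-integrable D (EFin \o g) ->
    mu.-integrable D (EFin \o (fun x => h x + g x)).
  by move=> ih ig; have := integrableD mD ih ig.
set v := qintegral mu D F.
have ir := iZ _ (qre v) iFr; have ii := iZ _ (qi v) iFi.
have ij := iZ _ (qj v) iFj; have ik := iZ _ (qk v) iFk.
have iri := iDD _ _ ir ii; have irij := iDD _ _ iri ij.
have vvE : qmod v ^+ 2 = \int[mu]_(x in D) qdot v (F x).
  rewrite /qdot (RintegralD mD irij ik) (RintegralD mD iri ij).
  by rewrite (RintegralD mD ir ii) !RintegralZl// -qdotxx.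
have vle : qmod v ^+ 2 <= qmod v * \int[mu]_(x in D) qmod (F x).
  rewrite vvE -RintegralZl//; apply: le_Rintegral => //.
  - exact: (iDD _ _ irij ik).
  - exact: iZ.
  - by move=> x _; exact: qdot_le.
rewrite -[leRHS]fineK; last exact: (integrable_fin_num mD iM).
rewrite lee_fin; have := qmod_ge0 v.
rewrite le_eqVlt => /predU1P[<-|v0].
  by apply: Rintegral_ge0 => x _; exact: qmod_ge0.
by move: vle; rewrite expr2 ler_pM2l.
Qed.

End QuaternionIntegration.

(** * Measurability and modulus of the kernels and constants *)

Section DunklKernel.
Variable R : realType.
Local Notation mu := (@lebesgue_measure R).

(** The positive and negative parts have measurable partial integrals by Tonelli's theorem, and
    [fine] is measurable, so no integrability in [t] enters. *)
Lemma measurable_Rintegral_param d (T : measurableType d) (D : set R)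
    (F : T * R -> R) : measurable D -> measurable_fun setT F ->
  measurable_fun setT (fun x => \int[mu]_(t in D) F (x, t)).
Proof.
move=> mD mF; apply: (measurableT_comp (fine_measurable measurableT)).
pose G (z : T * R) : \bar R := (F z * \1_D z.2)%:E.
have mG : measurable_fun setT G.
  apply/measurable_EFinP; apply: measurable_funM => //.
  by apply: measurableT_comp => //; exact: measurable_indic.
have GE x : (\int[mu]_(t in D) (F (x, t))%:E =
    \int[mu]_t (G^\+ (x, t)) - \int[mu]_t (G^\- (x, t)))%E.
  rewrite integral_mkcond integralE; congr (_ - _)%E;
    apply: eq_integral => t _; rewrite ?funeposE ?funenegE /G patchE indicE /=;
    by case: ifP; rewrite ?mulr1 ?mulr0.
under eq_fun do rewrite GE.
apply: emeasurable_funB.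
- have mGp : measurable_fun setT (G^\+)%E by exact: measurable_funepos.
  exact: (measurable_fun_fubini_tonelli_F (m2 := mu) _ mGp).
- have mGn : measurable_fun setT (G^\-)%E by exact: measurable_funeneg.
  exact: (measurable_fun_fubini_tonelli_F (m2 := mu) _ mGn).
Qed.

Lemma dunkl_kernelE chi (u s : R) (q : quat R) : q ^+ 2 = -1 ->
  dunkl_kernel chi u (s *: q) = kernel_norm chi *:
  qintegral mu `[-1, 1] (fun t => kernel_weight chi t *:
    (cos (u * t * s) *: 1 + sin (u * t * s) *: q)).
Proof.
move=> q2; rewrite /dunkl_kernel; congr (_ *: qintegral _ _ _).
by apply/funext => t; rewrite scalerA qexp_unit.
Qed.

Lemma qmeasurableZ_cos_sin d (T : measurableType d) (w r : T -> R)
    (q : quat R) :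
  measurable_fun setT w -> measurable_fun setT r ->
  qmeasurable (fun x => w x *: (cos (r x) *: 1 + sin (r x) *: q)).
Proof.
move=> mw mr.
have mc : measurable_fun setT (fun x => cos (r x)).
  apply: measurableT_comp => //.
  by apply: continuous_measurable_fun; exact: continuous_cos.
have ms : measurable_fun setT (fun x => sin (r x)).
  apply: measurableT_comp => //.
  by apply: continuous_measurable_fun; exact: continuous_sin.
by have [? ? ? ?] := qmeasurable_cos_sin q mc ms; split; exact: measurable_funM.
Qed.

Lemma qmeasurable_dunkl_kernel chi (s : R) (q : quat R) : q ^+ 2 = -1 ->
  qmeasurable (fun u : R => dunkl_kernel chi u (s *: q)).
Proof.
move=> q2.
have -> : (fun u : R => dunkl_kernel chi u (s *: q)) = fun u =>
    kernel_norm chi *: qintegral mu `[-1, 1] (fun t => kernel_weight chi t *: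
    (cos (u * t * s) *: 1 + sin (u * t * s) *: q)).
  by apply/funext => u; exact: dunkl_kernelE.
have mr : measurable_fun setT (fun z : R * R => z.1 * z.2 * s).
  by apply: measurable_funM => //; exact: measurable_funM.
have mw : measurable_fun setT (fun z : R * R => kernel_weight chi z.2).
  by apply: measurableT_comp => //; exact: measurable_kernel_weight.
have [mre mi mj mk] := qmeasurableZ_cos_sin q mw mr.
split; apply: measurable_funM => //.
- by have := measurable_Rintegral_param (measurable_itv `[-1, 1]) mre.
- by have := measurable_Rintegral_param (measurable_itv `[-1, 1]) mi.
- by have := measurable_Rintegral_param (measurable_itv `[-1, 1]) mj.
- by have := measurable_Rintegral_param (measurable_itv `[-1, 1]) mk.
Qed.

(** The exponential has modulus 1, so the integrand has modulus [kernel_weight], whose integral is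
    the inverse of [kernel_norm]. *)
Lemma qmod_dunkl_kernel_le1 chi (u s : R) (q : quat R) : q ^+ 2 = -1 ->
  qmod (dunkl_kernel chi u (s *: q)) <= 1.
Proof.
move=> q2; rewrite dunkl_kernelE// qmodZ ger0_norm ?kernel_norm_ge0//.
(* If the constant is 0, so is the kernel; otherwise [N0] gives the finite value of the weight
   integral. *)
have [->|N0] := eqVneq (kernel_norm chi) 0; first by rewrite mul0r.
set F := (X in qintegral _ _ X).
have mF : qmeasurable F.
  apply: (@qmeasurableZ_cos_sin _ _ (kernel_weight chi) (fun t => u * t * s)).
    exact: measurable_kernel_weight.
  by apply: measurable_funM => //; exact: measurable_funM.
have IF : (\int[mu]_(t in `[(-1)%R, 1%R]) (qmod (F t))%:E =
    ((kernel_norm chi)^-1)%:E)%E.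
  rewrite -integral_kernel_weightE//; apply: eq_integral => t; rewrite inE => tI.
  rewrite qmodZ qmodDZ// cos2Dsin2 sqrtr1 mulr1 ger0_norm//.
  exact: kernel_weight_ge0.
have := @le_qmod_qintegral _ _ _ mu `[-1, 1] F (measurable_itv _) mF.
rewrite IF ltry lee_fin => /(_ isT) h.
rewrite -[leRHS](divff N0); apply: ler_wpM2l h; exact: kernel_norm_ge0.
Qed.

Lemma qmeasurable_frac_chirp theta (q : quat R) (y : R) : q ^+ 2 = -1 ->
  qmeasurable (fun x => frac_chirp theta q x y).
Proof.
move=> q2.
pose r (x : R) := - ((x ^+ 2 + y ^+ 2) * cot theta / 2).
have mr : measurable_fun setT r.
  apply: measurableT_comp => //; do 2 (apply: measurable_funM => //).
  by apply: measurable_funD => //; exact: measurable_funX.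
(* The constant weight 1 brings the chirp into the form of [qmeasurableZ_cos_sin]. *)
have -> : (fun x => frac_chirp theta q x y) =
    fun x => 1 *: (cos (r x) *: 1 + sin (r x) *: q).
  by apply/funext => x; rewrite scale1r /frac_chirp qexp_unit.
exact: qmeasurableZ_cos_sin.
Qed.

Lemma qmod_frac_chirp theta (q : quat R) (x y : R) : q ^+ 2 = -1 ->
  qmod (frac_chirp theta q x y) = 1.
Proof. exact: qmod_qexp_unit. Qed.

Lemma qmod_frac_const chi theta (q : quat R) : q ^+ 2 = -1 ->
  qmod (frac_const chi theta q) =
  (`|sin theta| `^ (chi + 1))^-1 * (2 `^ (chi + 1) * Gamma (chi + 1))^-1.
Proof.
move=> q2; rewrite qmodZ qmod_qexp_unit// mulr1 ger0_norm//.
by rewrite mulr_ge0 ?invr_ge0 ?mulr_ge0 ?powR_ge0 ?Gamma_ge0.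
Qed.

Lemma qmeasurable_comp d d' (T : measurableType d) (T' : measurableType d')
    (g : T -> T') (F : T' -> quat R) : measurable_fun setT g ->
  qmeasurable F -> qmeasurable (F \o g).
Proof.
move=> mg [Fr Fi Fj Fk]; split.
- exact: (measurableT_comp Fr mg).
- exact: (measurableT_comp Fi mg).
- exact: (measurableT_comp Fj mg).
- exact: (measurableT_comp Fk mg).
Qed.

End DunklKernel.

(** * The bound for the transform *)

Theorem proposition3p4 (R : realType) (chi1 chi2 theta1 theta2 : R)
    (a b : quat R) (f : R * R -> quat R)
    (chi1_ge0 : 0 <= chi1) (chi2_ge0 : 0 <= chi2)
    (theta1_npi : forall k : int, theta1 <> k%:~R * pi)
    (theta2_npi : forall k : int, theta2 <> k%:~R * pi)
    (a_pure : pure_quat a) (b_pure : pure_quat b)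
    (a_sqr : a ^+ 2 = -1) (b_sqr : b ^+ 2 = -1)
    (f_L1 : qL1 (dunkl_measure chi1 chi2) f) :
  let C : R := (Gamma (chi1 + 1) * Gamma (chi2 + 1) * 2 `^ (chi1 + chi2 + 2) *
    `|sin theta1| `^ (chi1 + 1) * `|sin theta2| `^ (chi2 + 1))^-1 in
  (qnormoo (dunkl_measure chi1 chi2)
     (frac_dunkl_transform chi1 chi2 theta1 theta2 a b f)
   <= C%:E * qnorm1 (dunkl_measure chi1 chi2) f)%E.
Proof.
have [mf foo] := f_L1; cbv zeta; set C := (X in (X%:E * _)%E).
(* The estimate is shown at every [y], not just almost everywhere. *)
rewrite /qnormoo; apply/ess_supP; apply: nearW => y.
pose F x := frac_kernel_left chi1 theta1 a x.1 y.1 * f x *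
            frac_kernel_right chi2 theta2 b x.2 y.2.
have mF : qmeasurable F.
  apply: qmeasurable_mul; first apply: qmeasurable_mul => //.
    apply: (@qmeasurable_comp _ _ _ _ _ fst
      (frac_kernel_left chi1 theta1 a ^~ y.1)) => //.
    apply: qmeasurable_mul; first exact: qmeasurable_frac_chirp.
    exact: qmeasurable_dunkl_kernel.
  apply: (@qmeasurable_comp _ _ _ _ _ snd
    (frac_kernel_right chi2 theta2 b ^~ y.2)) => //.
  apply: qmeasurable_mul; first exact: qmeasurable_dunkl_kernel.
  exact: qmeasurable_frac_chirp.
have Ff x : qmod (F x) <= qmod (f x).
  have [pl pr] : qmod (frac_kernel_left chi1 theta1 a x.1 y.1) <= 1 /\
      qmod (frac_kernel_right chi2 theta2 b x.2 y.2) <= 1.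
    split.
      by rewrite /frac_kernel_left qmodM qmod_frac_chirp// mul1r
        qmod_dunkl_kernel_le1.
    by rewrite /frac_kernel_right qmodM qmod_frac_chirp// mulr1
      qmod_dunkl_kernel_le1.
  rewrite /F (qmodM (_ * _)) qmodM -[leRHS]mulr1.
  apply: ler_pM => //; rewrite ?mulr_ge0 ?qmod_ge0//.
  by rewrite ler_piMl ?qmod_ge0.
have IFf : (\int[dunkl_measure chi1 chi2]_x (qmod (F x))%:E <=
    qnorm1 (dunkl_measure chi1 chi2) f)%E.
  apply: ge0_le_integral => //.
  - by move=> x _; rewrite lee_fin qmod_ge0.
  - by apply/measurable_EFinP; exact: measurable_qmod.
  - by apply/measurable_EFinP; exact: measurable_qmod.
  - by move=> x _; rewrite lee_fin; exact: Ff.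
(* The finite norm of [f] also supplies the finiteness that the triangle inequality asks of [F]. *)
have := le_qmod_qintegral measurableT mF (le_lt_trans IFf foo).
move=> /le_trans/(_ IFf) IF.
(* The exponential factors of the constants have modulus 1, so [C] is exactly the product of the two
   moduli once the power of 2 is split. *)
have CE : C = qmod (frac_const chi1 theta1 a) * qmod (frac_const chi2 theta2 b).
  rewrite (qmod_frac_const _ _ a_sqr) (qmod_frac_const _ _ b_sqr) /C.
  have -> : chi1 + chi2 + 2 = (chi1 + 1) + (chi2 + 1) by ring.
  rewrite powRD; last by apply/implyP => _; rewrite pnatr_eq0.
  by rewrite !invfM; ring.
rewrite /frac_dunkl_transform (qmodM (_ * _)) qmodM -CE EFinM lee_pmul//.
- by rewrite lee_fin CE mulr_ge0 ?qmod_ge0.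
- by rewrite lee_fin qmod_ge0.
Qed.
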